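(* Let $X = X_\vartheta$ be the subshift of a primitive random substitution $\vartheta$. Then $h_{\mathrm{top}}(X) = 0$ if and only if $X$ is the subshift of a deterministic substitution; moreover, in this case the deterministic substitution can be taken to be primitive. (Equivalently: $h_{\mathrm{top}}(X)=0$ $\Leftrightarrow$ $X$ is the subshift of a deterministic substitution $\Leftrightarrow$ $X$ is the subshift of a primitive deterministic substitution.)
   Context: Let $\mathcal{A}$ be a finite alphabet, $\mathcal{A}^+$ the set of non-empty finite words over $\mathcal{A}$. A random substitution over $\mathcal{A}$ is a map $\vartheta$ assigning to each letter $a\in\mathcal{A}$ a non-empty finite set $\vartheta(a)\subset\mathcal{A}^+$ of realisations (together with a choice of strictly positive probabilities on each $\vartheta(a)$, which plays no role for the subshift and is ignored). It is deterministic if $\#\vartheta(a)=1$ for all $a\in\mathcal{A}$. For a word $u=u_1\cdots u_n$, $\vartheta(u)=\{w_1\cdots w_n : w_i\in\vartheta(u_i)\}$; powers are defined by $\vartheta^1=\vartheta$ and $\vartheta^k(a)=\bigcup_{v\in\vartheta^{k-1}(a)}\vartheta(v)$. A word is $\vartheta$-legal if it is a (contiguous) subword of some word in $\vartheta^k(a)$ for some $k\in\mathbb{N}$, $a\in\mathcal{A}$; $\mathcal{L}_\vartheta$ is the set of legal words. The subshift of $\vartheta$ is $X_\vartheta=\{w\in\mathcal{A}^{\mathbb{Z}} : \text{every finite subword of } w \text{ lies in } \mathcal{L}_\vartheta\}$ with the left shift. $\vartheta$ is primitive if there is $k\in\mathbb{N}$ such that for all $a,b\in\mathcal{A}$ the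 letter $a$ occurs in at least one realisation in $\vartheta^k(b)$; by convention, the definition of primitivity is restricted to random substitutions with $X_\vartheta\neq\varnothing$. For a non-empty subshift $X$, $p_X(n)$ is the number of distinct words of length $n$ occurring in elements of $X$, and $h_{\mathrm{top}}(X)=\lim_{n\to\infty}\frac1n\log p_X(n)$. *)

(* Defs.v *)
From mathcomp Require Import all_boot all_order all_algebra finmap.
From mathcomp Require Import all_classical all_reals all_analysis.

Set Implicit Arguments.
Unset Strict Implicit.
Unset Printing Implicit Defensive.

Import Order.TTheory GRing.Theory Num.Theory.
Import numFieldNormedType.Exports.

Local Open Scope classical_set_scope.
Local Open Scope fset_scope.
Local Open Scope ring_scope.

(* The probabilities attached to the realisations are left out: the subshift
   depends only on the sets of realisations. *)
Record random_substitution (A : finType) := RandomSubstitution {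
  realisations :> A -> {fset (seq A)};
  realisations_neq0 : forall a, realisations a != fset0;
  realisations_nonempty : forall a w, w \in realisations a -> w != [::]
}.

Section RandomSubstitution.
Variable A : finType.
Implicit Types theta : random_substitution A.

Definition deterministic theta : Prop := forall a, #|` theta a| = 1%N.

Fixpoint word_realisations theta (u : seq A) : {fset (seq A)} :=
  if u is a :: u' then
    [fset v ++ w | v in theta a, w in word_realisations theta u']
  else [fset [::]].

(* The recursion starts at the identity power 0, which the notions below
   exclude: they only use exponents k >= 1. *)
Fixpoint power theta (k : nat) (a : A) : {fset (seq A)} :=
  if k is k'.+1 then \bigcup_(v <- power theta k' a) word_realisations theta v
  else [fset [:: a]].

Lemma power1 theta a : power theta 1 a = theta a.
Proof.
rewrite /= big_seq_fset1 /=; apply/fsetP => w; apply/imfset2P/idP => /=.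
  by move=> [v hv [u]]; rewrite !inE => /eqP -> ->; rewrite cats0.
by move=> hw; exists w => //; exists [::]; rewrite ?inE ?cats0.
Qed.

Definition legal theta (u : seq A) : Prop :=
  exists k a w, [/\ (0 < k)%N, w \in power theta k a & infix u w].

Definition subword (x : int -> A) (i : int) (n : nat) : seq A :=
  mkseq (fun j => x (i + j%:Z)) n.

Definition subshift theta : set (int -> A) :=
  [set x | forall i n, legal theta (subword x i n)].

Definition primitive theta : Prop :=
  subshift theta !=set0 /\
  exists2 k, (0 < k)%N &
    forall a b, exists2 w, w \in power theta k b & a \in w.

Definition complexity (X : set (int -> A)) (n : nat) : nat :=
  #|[set w : n.-tuple A |
      `[< exists2 x, X x & exists i, subword x i n = w >]]%SET|.

(* For X nonempty, n |-> ln (complexity X n) is subadditive and nonnegative, so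
   the limit exists and `limn` does not take its default value. *)
Definition topological_entropy (R : realType) (X : set (int -> A)) : R :=
  limn (fun n => ln ((complexity X n)%:R : R) / n%:R).

End RandomSubstitution.

(* Main.v *)
Require Import Defs.
From mathcomp Require Import all_boot all_order all_algebra finmap.
From mathcomp Require Import all_classical all_reals all_analysis.
From mathcomp Require Import zify lra.

(* If theta is not deterministic, let u <> v be realisations of a letter a with
   |u| <= |v|.  Whenever a y a is legal and x is a realisation of y, zero entropy
   forces u x v = v x u: otherwise, by primitivity, some power of theta maps each
   letter to two distinct words of equal length, and choosing freely between
   them yields exponentially many legal words.  Hence |u| < |v|, v = u t, and
   x u commutes with t, so every legal word is a factor of a power of t, and the
   subshift is that of the constant substitution with value t t.

   Conversely, let f be deterministic.  A factor of length n >= 2 of some f^k(a)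
   straddles a cut in some f^j(v1) f^j(v2) with v1 v2 = f(b), so it is a suffix
   of f^j(v1) followed by a prefix of f^j(v2).  If f^q has idempotent first and
   last letter maps, the prefix and the suffix of length m of f^(iq)(w) do not
   depend on i >= m; hence O(n) values of j suffice, and there are O(n^2) legal
   words of length n. *)

Set Implicit Arguments.
Unset Strict Implicit.
Unset Printing Implicit Defensive.

(** * Words and morphisms *)

Section Words.
Variable A : eqType.
Implicit Types (s t u v w z : seq A) (f h : A -> seq A).

Definition word_pow t n := flatten (nseq n t).

Lemma size_word_pow t n : size (word_pow t n) = n * size t.
Proof. by rewrite size_flatten /shape map_nseq sumn_nseq mulnC. Qed.

Lemma word_powD t m n : word_pow t (m + n) = word_pow t m ++ word_pow t n.
Proof. by rewrite /word_pow nseqD flatten_cat. Qed.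

Lemma word_powM t m n : word_pow (word_pow t m) n = word_pow t (n * m).
Proof. by elim: n => // n IH; rewrite mulSn word_powD -IH. Qed.

Lemma prefix_word_pow_le t m n : m <= n -> prefix (word_pow t m) (word_pow t n).
Proof. by move=> /subnKC <-; rewrite word_powD prefix_prefix. Qed.

Lemma prefix_prefix_size s t w :
  prefix s w -> prefix t w -> size s <= size t -> prefix s t.
Proof.
by move=> sw /prefixP[t' e] le; move: sw; rewrite !prefixE e takel_cat.
Qed.

(** As [z] commutes with every power of [t], both [z] and [word_pow t (size z)] are prefixes of
    [word_pow t (size z) ++ z], and the power is at least as long as [z]. *)
Lemma commute_prefix_pow z t :
  t != [::] -> z ++ t = t ++ z -> prefix z (word_pow t (size z)).
Proof.
move=> t0 zt.
have ztn n : z ++ word_pow t n = word_pow t n ++ z.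
  elim: n => [|n IH]; first by rewrite cats0.
  by rewrite /word_pow /= -/(word_pow t n) catA zt -!catA IH.
apply: (@prefix_prefix_size _ _ (word_pow t (size z) ++ z)); last 1 first.
- by rewrite size_word_pow leq_pmulr // lt0n size_eq0.
- by rewrite -ztn prefix_prefix.
- exact: prefix_prefix.
Qed.

Lemma infix_catP w s t :
  infix w (s ++ t) ->
  [\/ infix w s, infix w t |
   exists2 m, m <= size w & suffix (take m w) s && prefix (drop m w) t].
Proof.
elim: s => [|x s IH]; first by move=> ?; apply: Or32.
rewrite cat_cons infix_consl => /orP[|/IH[h|h|[m le /andP[h1 h2]]]].
- rewrite -cat_cons => /prefixP[w' e].
  have [le|lt] := leqP (size w) (size (x :: s)).
    apply: Or31; apply: prefixW.
    by apply: (prefix_prefix_size _ (prefix_prefix (x :: s) t)) => //;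
       rewrite e prefix_prefix.
  apply: Or33; exists (size (x :: s)); first exact: ltnW.
  have -> : take (size (x :: s)) w = x :: s.
    by have := congr1 (take (size (x :: s))) e; rewrite take_size_cat // takel_cat // ltnW.
  rewrite suffix_refl /=; apply/prefixP; exists w'.
  have := congr1 (drop (size (x :: s))) e; rewrite drop_size_cat // => ->.
  by rewrite drop_cat lt.
- by apply: Or31; rewrite infix_consl h orbT.
- exact: Or32.
- by apply: Or33; exists m; rewrite // h2 andbT (suffix_trans h1) // -cat1s suffix_suffix.
Qed.

(** Suffix of length [m], written through [rev] so that facts about [take] and iterated morphisms
    carry over by [rev_iter_morph]. *)
Definition lastn m w := rev (take m (rev w)).

Lemma lastn_suffix s w m : suffix s w -> size s = m -> lastn m w = s.
Proof.
by move=> /suffixP[p ->] <-; rewrite /lastn rev_cat take_size_cat ?revK ?size_rev.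
Qed.

Definition morph f w := flatten (map f w).

Lemma morph_cat f u v : morph f (u ++ v) = morph f u ++ morph f v.
Proof. by rewrite /morph map_cat flatten_cat. Qed.

Lemma morph1 f a : morph f [:: a] = f a.
Proof. by rewrite /morph /= cats0. Qed.

Lemma iter_morph_cat f k u v :
  iter k (morph f) (u ++ v) = iter k (morph f) u ++ iter k (morph f) v.
Proof. by elim: k => //= k ->; rewrite morph_cat. Qed.

Lemma iter_morph0 f k : iter k (morph f) [::] = [::].
Proof. by elim: k => //= k ->. Qed.

Lemma iter_morphE f k w :
  iter k (morph f) w = morph (fun a => iter k (morph f) [:: a]) w.
Proof.
elim: w => [|a w IH]; first exact: iter_morph0.
by rewrite -cat1s iter_morph_cat IH -[RHS]/(_ ++ _).
Qed.

Lemma rev_morph f w : rev (morph f w) = morph (rev \o f) (rev w).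
Proof.
elim: w => // a w IH.
rewrite -cat1s morph_cat !rev_cat IH morph_cat; congr (_ ++ _).
by rewrite -[rev [:: a]]/[:: a] !morph1.
Qed.

Lemma rev_iter_morph f k w :
  rev (iter k (morph f) w) = iter k (morph (rev \o f)) (rev w).
Proof. by elim: k w => //= k IH w; rewrite rev_morph IH. Qed.

Lemma size_iter_morph f k w : (forall a, f a != [::]) ->
  size w <= size (iter k (morph f) w).
Proof.
move=> f0; elim: k => //= k /leq_trans; apply; elim: (iter _ _ _) => // a u IH.
rewrite -cat1s morph_cat morph1 !size_cat; apply: leq_add => //=.
by rewrite lt0n size_eq0.
Qed.

(* When every [h d] starts with [d], either [h d = d] and the letter can be
   stripped, or [h^i d] has length at least [i + 1] and is a prefix of
   [h^(i+1) d]. *)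
Lemma take_iter_morph_stable h :
  (forall a, exists d z z', h a = d :: z' /\ h d = d :: z) ->
  forall m i w, m <= i ->
    take m (iter i (morph h) w) = take m (iter m (morph h) w).
Proof.
move=> hP.
have h0 a : h a != [::] by have [d [z [z' [-> _]]]] := hP a.
have step m i w : m <= i ->
    take m (iter i.+1 (morph h) w) = take m (iter i (morph h) w).
  elim: m i w => [|m IH] i w; first by rewrite !take0.
  case: i => // i le_mi.
  case: w => [|a w]; first by rewrite !iter_morph0.
  have [d [z [z' [ha hd]]]] := hP a.
  (* One application of [h] is spent on reaching a first letter [d] with [h d] starting with [d];
     this leaves [i >= m] applications to settle [m.+1] letters. *)
  have e : morph h (a :: w) = [:: d] ++ (z' ++ morph h w) by rewrite /morph /= ha.
  rewrite iterSr e [in RHS]iterSr e; move: (z' ++ _) => w'.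
  have [z0|z0] := eqVneq z [::].
    have fixd j : iter j (morph h) [:: d] = [:: d].
      by elim: j => //= j ->; rewrite morph1 hd z0.
    by rewrite !iter_morph_cat !fixd; congr (d :: _); apply: IH.
  have grow j : j < size (iter j (morph h) [:: d]).
    elim: j => // j IHj; rewrite iterSr morph1 hd -cat1s iter_morph_cat size_cat.
    rewrite -addn1 leq_add //; apply: leq_trans (size_iter_morph _ _ h0).
    by rewrite lt0n size_eq0.
  rewrite (iter_morph_cat h i.+1) iterSr morph1 hd -[d :: z]cat1s !iter_morph_cat.
  have sz : m < size (iter i (morph h) [:: d]) by apply: leq_trans (grow i).
  by rewrite -catA !takel_cat.
move=> m i w le_mi; rewrite -(subnKC le_mi); elim: (i - m) => [|j IH].
  by rewrite addn0.
by rewrite addnS step ?leq_addr.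
Qed.

Lemma infix_morph f w v :
  infix w (morph f v) ->
  (exists2 c, c \in v & infix w (f c)) \/
  (exists v1 v2 m, [/\ v = v1 ++ v2, m <= size w,
     suffix (take m w) (morph f v1) & prefix (drop m w) (morph f v2)]).
Proof.
elim: v => [|c v IH].
  by rewrite infixs0 => /eqP ->; right; exists [::], [::], 0.
rewrite -cat1s morph_cat morph1 => /infix_catP[h|/IH h|[m le /andP[h1 h2]]].
- by left; exists c; rewrite ?mem_head.
- case: h => [[d dv h]|[v1 [v2 [m [ev le h1 h2]]]]].
    by left; exists d; rewrite ?inE ?dv ?orbT.
  right; exists (c :: v1), v2, m; split=> //; first by rewrite ev.
  by rewrite -cat1s morph_cat (suffix_trans h1) // suffix_suffix.
- by right; exists [:: c], v, m; split=> //; rewrite morph1.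
Qed.

(** Descend while [w] lies in the iterated image of a single letter. As [w] has at least two
    letters, this stops before level 0, and there [w] is split by the cut at position [c] of some
    [f b]. *)
Lemma infix_iter_morph f k w a :
  1 < size w -> infix w (iter k (morph f) [:: a]) ->
  exists b c j m, [/\ m <= size w,
     suffix (take m w) (iter j (morph f) (take c (f b))),
     prefix (drop m w) (iter j (morph f) (drop c (f b))) & c <= size (f b)].
Proof.
move=> w1; elim: k a => [|k IH] a.
  by move/size_infix; rewrite /= leqNgt w1.
rewrite iterSr morph1 iter_morphE => /infix_morph[[c _ /IH //]|].
move=> [v1 [v2 [m [ev le h1 h2]]]]; exists a, (size v1), k, m.
rewrite ev take_size_cat // drop_size_cat // iter_morphE [iter k _ v2]iter_morphE.
by rewrite size_cat leq_addr.
Qed.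

End Words.

(** By pigeonhole two iterates of [g] coincide, which gives a preperiod [i] and a period [p]; a
    positive multiple of [p] that is at least [i] is an idempotent exponent. *)
Lemma iter_fin_idempotent (T : finType) (g : T -> T) :
  exists2 q, 0 < q & forall x, iter q g (iter q g x) = iter q g x.
Proof.
pose F n : {ffun T -> T} := [ffun x => iter n g x].
have [i [p [p0 per]]] : exists i p, 0 < p /\ forall x, iter (i + p) g x = iter i g x.
  have : ~~ injectiveb (fun k : 'I_(#|{ffun T -> T}|.+1) => F k).
    by apply/negP => /injectiveP /leq_card; rewrite card_ord ltnn.
  move=> /injectivePn[i [j ij eF]].
  wlog lt_ij : i j ij eF / i < j.
    move=> H; case: (ltngtP i j) => lij; [exact: (H i j)| |].
      by apply: (H j i); rewrite // eq_sym.
    by move/eqP: ij; case; apply: val_inj.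
  exists i, (j - i); split; first by rewrite subn_gt0.
  move=> x; rewrite subnKC ?(ltnW lt_ij) //.
  by have /ffunP/(_ x) := eF; rewrite !ffunE.
have per' m n x : i <= n -> iter (n + m * p) g x = iter n g x.
  move=> le; elim: m => [|m IH]; first by rewrite addn0.
  rewrite mulSn (_ : n + _ = (n + m * p - i) + (i + p)); last by lia.
  by rewrite iterD per -iterD subnK //; lia.
exists (p * i.+1) => [|x]; first by rewrite muln_gt0 p0.
by rewrite -iterD [X in _ + X]mulnC per' //; nia.
Qed.

(** * Counting factors of iterated morphisms *)

Definition first_letter (A : eqType) (f : A -> seq A) a := head a (f a).

Lemma iter_morph_cons (A : eqType) (f : A -> seq A) k a w :
  (forall b, f b != [::]) ->
  exists z, iter k (morph f) (a :: w) = iter k (first_letter f) a :: z.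
Proof.
move=> f0; elim: k => [|k [z IH]]; first by exists w.
rewrite !iterS IH /morph /=; have := f0 (iter k (first_letter f) a).
by rewrite /first_letter; case: (f _) => // b y _ /=; exists (y ++ flatten (map f z)).
Qed.

(** Idempotence makes [h = f^q] satisfy the hypothesis of [take_iter_morph_stable], with [d] the
    first letter of [h a]. *)
Lemma take_iter_morph_mul (A : eqType) (f : A -> seq A) q :
  (forall a, f a != [::]) ->
  (forall x, iter q (first_letter f) (iter q (first_letter f) x) =
             iter q (first_letter f) x) ->
  forall m i w, m <= i ->
    take m (iter (i * q) (morph f) w) = take m (iter (m * q) (morph f) w).
Proof.
move=> f_neq0 idem.
pose h a := iter q (morph f) [:: a].
have hE i w : iter (i * q) (morph f) w = iter i (morph h) w.
  elim: i w => // i IH w; rewrite mulSn iterD IH iterS -iter_morphE //.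
move=> m i w le; rewrite !hE; apply: take_iter_morph_stable => // a.
have [z' e'] := iter_morph_cons q a [::] f_neq0.
have [z e] := iter_morph_cons q (iter q (first_letter f) a) [::] f_neq0.
by exists (iter q (first_letter f) a), z, z'; split=> //; rewrite /h e idem.
Qed.

(** From the threshold [n * q] on, only the residue of [k] modulo [q] will matter for the first [n]
    letters. *)
Definition reduce_exponent q n k := if k < n * q then k else n * q + k %% q.

Lemma reduce_exponent_lt q n k : 0 < q -> reduce_exponent q n k < n.+1 * q.
Proof.
by rewrite /reduce_exponent mulSn => q0; have := ltn_pmod k q0; case: (ltnP k (n * q)); lia.
Qed.

Lemma take_reduce_exponent (A : eqType) (f : A -> seq A) q :
  0 < q -> (forall a, f a != [::]) ->
  (forall x, iter q (first_letter f) (iter q (first_letter f) x) =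
             iter q (first_letter f) x) ->
  forall m n k w, m <= n ->
    take m (iter k (morph f) w) = take m (iter (reduce_exponent q n k) (morph f) w).
Proof.
move=> q0 f0 idem m n k w le; rewrite /reduce_exponent; case: ltnP => // le_k.
rewrite {1}(divn_eq k q) !iterD !(take_iter_morph_mul f0 idem) //.
by apply: leq_trans le _; rewrite leq_divRL.
Qed.

(** A factor is determined by the letter [b], the position [c] of the cut in [f b], the number [m]
    of letters left of the cut and the reduced exponent; the last two take O(n) values each. *)
Lemma morphism_factor_count (A : finType) (f : A -> seq A) :
  (forall a, f a != [::]) ->
  exists C, forall n (S : {set n.-tuple A}), 1 < n ->
    (forall w, w \in S -> exists k a, infix w (iter k (morph f) [:: a])) ->
    #|S| <= C * n.+1 ^ 2.
Proof.
move=> f0; pose g := rev \o f.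
have g0 a : g a != [::] by rewrite /g /= -size_eq0 size_rev size_eq0.
(* Running [f] and its mirror image [g] in parallel on pairs of letters yields one [q] that serves
   prefixes and suffixes alike. *)
have [q q0 idem] := iter_fin_idempotent
  (fun x : A * A => (first_letter f x.1, first_letter g x.2)).
have iterE k x : iter k (fun x : A * A => (first_letter f x.1, first_letter g x.2)) x
    = (iter k (first_letter f) x.1, iter k (first_letter g) x.2).
  by elim: k => [|k IH]; [case: x | rewrite !iterS IH].
have idemf x : iter q (first_letter f) (iter q (first_letter f) x) =
    iter q (first_letter f) x.
  by have := idem (x, x); rewrite !iterE => -[].
have idemg x : iter q (first_letter g) (iter q (first_letter g) x) =
    iter q (first_letter g) x.
  by have := idem (x, x); rewrite !iterE => -[].
pose M := \max_a size (f a).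
exists (#|A| * M.+1 * q) => n S n1 legS.
pose code := (A * 'I_M.+1 * 'I_n.+1 * 'I_(n.+1 * q))%type.
pose decode (x : code) : seq A :=
  let: (b, c, m, k) := x in
  lastn m (iter k (morph f) (take c (f b))) ++
  take (n - m) (iter k (morph f) (drop c (f b))).
have sub : {subset map val (enum S) <= map decode (enum {: code})}.
  move=> _ /mapP[w wS ->]; rewrite mem_enum in wS.
  have [k [a]] := legS w wS.
  have sw : size w = n by rewrite size_tuple.
  move=> /infix_iter_morph; rewrite sw => /(_ n1)[b [c [j [m [le_m h1 h2 le_c]]]]].
  have lt_c : c < M.+1 by rewrite ltnS (leq_trans le_c) // (leq_bigmax b).
  have lt_m : m < n.+1 by [].
  apply/mapP; exists (b, Ordinal lt_c, Ordinal lt_m,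
     Ordinal (reduce_exponent_lt n j q0)); first by rewrite mem_enum.
  rewrite /= -[in LHS](cat_take_drop m (val w)); congr (_ ++ _).
    rewrite /lastn rev_iter_morph -(take_reduce_exponent q0 g0 idemg) //.
    rewrite -rev_iter_morph; apply/esym; apply: lastn_suffix => //.
    by rewrite size_takel // sw.
  rewrite -(take_reduce_exponent q0 f0 idemf) ?leq_subr //.
  by move: h2; rewrite prefixE size_drop sw => /eqP.
have uniqS : uniq (map val (enum S)).
  by rewrite map_inj_uniq ?enum_uniq //; apply: val_inj.
have card_code : size (map decode (enum {: code})) = #|A| * M.+1 * n.+1 * (n.+1 * q).
  by rewrite size_map -cardE !card_prod !card_ord.
have := uniq_leq_size uniqS sub; rewrite card_code size_map -cardE => le.
by apply: leq_trans le _; apply: eq_leq; lia.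
Qed.

(** * Limits of averages *)

Section Averages.
Import Order.TTheory GRing.Theory Num.Theory.
Import numFieldNormedType.Exports.
Local Open Scope classical_set_scope.
Local Open Scope ring_scope.
Variable R : realType.

Lemma cvg_div_nat (a : nat -> R) (l : R) :
  (forall n, l * n%:R <= a n) ->
  (forall e, 0 < e -> exists C, forall n, a n <= (l + e) * n%:R + C) ->
  a n / n%:R @[n --> \oo] --> l.
Proof.
move=> lb ub; apply/cvgrPdist_le => e e0.
have [C hC] := ub (e / 2) ltac:(lra).
near=> n.
have n0 : 0 < n%:R :> R by rewrite ltr0n; near: n; exists 1%N.
have nC : 2 * C / e <= n%:R.
  by apply: ltW; near: n; apply: nbhs_infty_gtr.
rewrite ler_pdivrMr // in nC.
rewrite distrC ler_distl; apply/andP; split.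
  by rewrite ler_pdivlMr //; apply: le_trans (lb n); rewrite ler_pM2r //; lra.
by rewrite ler_pdivrMr //; apply: le_trans (hC n) _; lra.
Unshelve. all: by end_near. Qed.

(** Fekete's lemma: the limit is the infimum of [a n / n]. If [m] nearly attains it, dividing [n] by
    [m] bounds [a n] up to a constant coming from the remainder. *)
Lemma fekete (a : nat -> R) :
  (forall n, 0 <= a n) -> (forall m n, a (m + n)%N <= a m + a n) ->
  exists2 l : R, a n / n%:R @[n --> \oo] --> l & forall n, l * n%:R <= a n.
Proof.
move=> a0 sub; pose S := [set a n / n%:R | n in [set n | (0 < n)%N]].
have infS : has_inf S.
  split; first by exists (a 1%N / 1%:R), 1%N.
  by exists 0 => _ [n _ <-]; rewrite divr_ge0.
have lb n : inf S * n%:R <= a n.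
  case: n => [|n]; first by rewrite mulr0.
  rewrite -ler_pdivlMr ?ltr0n //; apply: ge_inf; first by case: infS.
  by exists n.+1.
exists (inf S) => //; apply: cvg_div_nat => // e e0.
have [_ [m m0 <-] lt_m] := inf_adherent e0 infS.
have subM q r : a (q * m + r)%N <= q%:R * a m + a r.
  elim: q => [|q IH]; first by rewrite mul0r add0r.
  rewrite mulSn -addnA; apply: le_trans (sub _ _) _.
  by rewrite -natr1 mulrDl mul1r [_ + a m]addrC -addrA lerD2l.
(* The terms being nonnegative, this sum bounds [a r] for every remainder [r < m] at once. *)
exists (\sum_(r < m) a r) => n; rewrite {1}(divn_eq n m).
apply: le_trans (subM _ _) _; apply: lerD; last first.
  by rewrite (bigD1 (Ordinal (ltn_pmod n m0))) //= lerDl sumr_ge0.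
have m0' : 0 < m%:R :> R by rewrite ltr0n.
have le0 : 0 <= inf S + e by apply: le_trans (ltW lt_m); rewrite divr_ge0.
move: lt_m; rewrite ltr_pdivrMr // => lt_m.
apply: (@le_trans _ _ ((n %/ m)%:R * ((inf S + e) * m%:R))).
  by rewrite ler_wpM2l // ltW.
rewrite mulrCA ler_wpM2l //.
by rewrite -natrM ler_nat leq_divM.
Qed.

(** This is [ln (1 + x) <= x] at [x = e * y - 1]. *)
Lemma ln_le_linear (e y : R) : 0 < e -> 0 < y -> ln y <= e * y - ln e.
Proof.
move=> e0 y0; have ey0 : 0 < e * y by rewrite mulr_gt0.
have := @le_ln1Dx R (e * y - 1); rewrite [1 + _]addrC subrK lnM ?posrE // => H.
have : ln e + ln y <= e * y - 1 by apply: H; lra.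
lra.
Qed.

Lemma cvg_ln_quadratic (p : nat -> nat) C :
  (forall n, (1 < n)%N -> (p n <= C * n.+1 ^ 2)%N) ->
  ln ((p n)%:R : R) / n%:R @[n --> \oo] --> (0 : R).
Proof.
move=> hp; apply: cvg_div_nat => [n|e e0].
  rewrite mul0r; case: (p n) => [|k]; first by rewrite ln0.
  by rewrite ln_ge0 // ler1n.
(* The factor [n.+1 ^ 2] costs twice the bound of [ln_le_linear] with slope [e / 2]. [C.+1] keeps
   the argument of [ln] positive, and the last two terms cover [n = 0] and [n = 1]. *)
exists (ln (C.+1%:R : R) + 2 * (e / 2 - ln (e / 2)) + ln ((p 0%N)%:R) + ln ((p 1%N)%:R)) => n.
have lnn k : 0 <= ln (k%:R : R).
  by case: k => [|k]; [rewrite ln0 | rewrite ln_ge0 // ler1n].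
have e20 : 0 < e / 2 by lra.
have lin := ln_le_linear e20 (ltr0Sn R n).
have l1 := lnn n.+1; have lC := lnn C.+1; have lp0 := lnn (p 0%N); have lp1 := lnn (p 1%N).
have nR : n.+1%:R = n%:R + 1 :> R by rewrite -natr1.
have n0 : 0 <= n%:R :> R by [].
have en0 : 0 <= e * n%:R by rewrite mulr_ge0 // ltW.
have [n1|] := ltnP 1 n; last first.
  have := ln_le_linear e20 (@ltr01 R); rewrite ln1 mulr1 => h.
  by case: n {l1 lin nR n0 en0} => [|[|n]] // _; lra.
have : ln ((p n)%:R) <= ln ((C.+1 * n.+1 ^ 2)%:R) :> R.
  case E: (p n) (hp n n1) => [|k] le; first by rewrite ln0.
  rewrite ler_ln ?posrE ?ltr0n ?muln_gt0 ?expn_gt0 // ler_nat.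
  by apply: leq_trans le _; rewrite leq_mul2r leqnSn orbT.
rewrite natrM natrX lnM ?posrE ?ltr0n ?exprn_gt0 ?ltr0n // lnXn ?ltr0n // mulr2n.
move: lin; rewrite nR; lra.
Qed.

End Averages.

(** * Legal words of random substitutions *)

Section Realisations.
Variables (A : finType) (theta : random_substitution A).
Implicit Types (u v w : seq A) (a b c : A).

Lemma word_realisations_consP a u w :
  reflect (exists v w', [/\ v \in theta a, w' \in word_realisations theta u & w = v ++ w'])
    (w \in word_realisations theta (a :: u)).
Proof.
apply: (iffP idP) => [/= /imfset2P[v hv [w' hw' ->]]|[v [w' [hv hw' ->]]]].
  by exists v, w'.
by apply/imfset2P; exists v => //; exists w'.
Qed.

Lemma word_realisations0 w : (w \in word_realisations theta [::]) = (w == [::]).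
Proof. by rewrite inE. Qed.

Lemma word_realisations_cat u v u' v' :
  u' \in word_realisations theta u -> v' \in word_realisations theta v ->
  u' ++ v' \in word_realisations theta (u ++ v).
Proof.
elim: u u' => [|a u IH] u'; first by rewrite word_realisations0 => /eqP ->.
move=> /word_realisations_consP[w [w' [hw hw' ->]]] hv; rewrite -catA.
by apply/word_realisations_consP; exists w, (w' ++ v'); split=> //; apply: IH.
Qed.

Lemma word_realisations1 a : word_realisations theta [:: a] =i theta a.
Proof.
move=> w; apply/word_realisations_consP/idP => [[v [w' [hv]]]|hw].
  by rewrite word_realisations0 => /eqP -> ->; rewrite cats0.
by exists w, [::]; rewrite word_realisations0 cats0.
Qed.

Lemma word_realisations_neq0 u : exists w, w \in word_realisations theta u.
Proof.
elim: u => [|a u [w hw]]; first by exists [::]; rewrite word_realisations0.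
have /fset0Pn[v hv] := realisations_neq0 theta a.
by exists (v ++ w); apply/word_realisations_consP; exists v, w.
Qed.

Lemma size_word_realisations u w :
  w \in word_realisations theta u -> size u <= size w.
Proof.
elim: u w => // a u IH w /word_realisations_consP[v [w' [hv /IH le ->]]].
rewrite size_cat -cat1s size_cat; apply: leq_add => //; rewrite lt0n size_eq0.
exact: realisations_nonempty hv.
Qed.

(** Relational form of [power], started from a word rather than a letter so that it composes and
    respects concatenation. *)
Fixpoint realises (k : nat) u w : Prop :=
  if k is k'.+1 then exists2 v, realises k' u v & w \in word_realisations theta v
  else w = u.

Lemma realises_powerP k a w : w \in power theta k a <-> realises k [:: a] w.
Proof.
elim: k w => [|k IH] w /=; first by rewrite inE; split=> [/eqP|->].
split=> [/bigfcupP[v /andP[hv _] hw]|[v /IH hv hw]]; first by exists v => //; apply/IH.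
by apply/bigfcupP; exists v; rewrite ?hv.
Qed.

Lemma realises_cat k u v u' v' :
  realises k u u' -> realises k v v' -> realises k (u ++ v) (u' ++ v').
Proof.
elim: k u' v' => [|k IH] u' v' /=; first by move=> -> ->.
move=> [w hw hu] [z hz hv]; exists (w ++ z); first exact: IH.
exact: word_realisations_cat.
Qed.

Lemma realises_trans k l u v w :
  realises k u v -> realises l v w -> realises (l + k) u w.
Proof.
move=> uv; elim: l w => [|l IH] w /=; first by move=> ->.
by move=> [z /IH]; exists z.
Qed.

Lemma realises_neq0 k u : exists w, realises k u w.
Proof.
elim: k => [|k [v hv]]; first by exists u.
by have [w hw] := word_realisations_neq0 v; exists w, v.
Qed.

Lemma size_realises k u w : realises k u w -> size u <= size w.
Proof.
elim: k w => [w /= -> //|k IH w [v /IH le /size_word_realisations]].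
exact: leq_trans.
Qed.

Lemma legalP u : legal theta u <->
  exists k a w, [/\ 0 < k, realises k [:: a] w & infix u w].
Proof.
by split=> -[k [a [w [k0 h uw]]]]; exists k, a, w; split=> //; apply/realises_powerP.
Qed.

Lemma legal_infix u v : infix v u -> legal theta u -> legal theta v.
Proof.
move=> vu [k [a [w [k0 hw uw]]]]; exists k, a, w; split=> //.
exact: infix_trans vu uw.
Qed.

Lemma realises_infix k u u' v :
  realises k u u' -> infix u v -> exists2 v', realises k v v' & infix u' v'.
Proof.
move=> h /infixP[p [q ->]].
have [p' hp] := realises_neq0 k p; have [q' hq] := realises_neq0 k q.
exists (p' ++ u' ++ q'); last exact: infix_infix.
by do 2!apply: realises_cat => //.
Qed.

Lemma legal_realises k u w : legal theta u -> realises k u w -> legal theta w.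
Proof.
move=> /legalP[l [a [v [l0 hv uv]]]] h.
have [v' hv' wv'] := realises_infix h uv.
apply/legalP; exists (k + l), a, v'; split=> //; first by rewrite addn_gt0 l0 orbT.
exact: realises_trans hv hv'.
Qed.

Lemma legal_word_realisations u w :
  legal theta u -> w \in word_realisations theta u -> legal theta w.
Proof. by move=> hu hw; apply: (@legal_realises 1 u) => //; exists u. Qed.

End Realisations.

(** * Legal words of primitive substitutions *)

Section Primitive.
Variables (A : finType) (theta : random_substitution A).
Hypothesis prim : primitive theta.
Implicit Types (u v w : seq A) (a b c : A).

Lemma legal_of_size n : exists2 w, legal theta w & size w = n.
Proof.
have [[x Xx] _] := prim; exists (subword x 0%R n); first exact: Xx.
by rewrite size_mkseq.
Qed.

(** Primitivity yields [c] from the first letter of any realisation of [b] at level [n - K], hence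
    at every level [n >= K]; [k] further steps yield [w]. *)
Lemma legal_recurrent w : legal theta w ->
  exists K, forall n b, K <= n -> exists2 W, realises theta n [:: b] W & infix w W.
Proof.
move=> /legalP[k [c [v [_ hv wv]]]]; have [_ [K K0 hK]] := prim.
have letter n b : K <= n -> exists2 W, realises theta n [:: b] W & c \in W.
  move=> le; have [z hz] := realises_neq0 theta (n - K) [:: b].
  have := size_realises hz; case: z hz => // d z hz _.
  have [W /realises_powerP hW cW] := hK c d.
  have dz : infix [:: d] (d :: z) by rewrite infix1s mem_head.
  have [W' hW' WW'] := realises_infix hW dz.
  exists W'; last exact: mem_infix WW' _ cW.
  by rewrite -(subnKC le); apply: realises_trans hz hW'.
exists (k + K) => n b le.
have [z hz] := letter (n - k) b ltac:(lia); rewrite -infix1s => cz.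
have [W hW vW] := realises_infix hv cz.
exists W; last exact: infix_trans wv vW.
by rewrite -[n](@subnKC k); [apply: realises_trans hz hW | lia].
Qed.

Lemma legal_letter a : legal theta [:: a].
Proof.
have [_ [K K0 hK]] := prim.
have [W hW aW] := hK a a.
by exists K, a, W; rewrite infix1s.
Qed.

(** Realise a legal two-letter word [b c] at a level where [b] can produce [u] and [c] can produce
    [v]. *)
Lemma legal_connect u v : legal theta u -> legal theta v ->
  exists w, legal theta (u ++ w ++ v).
Proof.
move=> /legal_recurrent[K hK] /legal_recurrent[L hL].
have [[|b [|c [|]]] // hbc _] := legal_of_size 2.
have [W hW /infixP[p [q eW]]] := hK (K + L) b (leq_addr _ _).
have [Z hZ /infixP[r [s eZ]]] := hL (K + L) c (leq_addl _ _).
exists (q ++ r); have := legal_realises hbc (realises_cat hW hZ).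
apply: legal_infix; apply/infixP; exists p, s.
by rewrite eW eZ !catA.
Qed.

Lemma legal_preimage w : legal theta w ->
  exists u v, [/\ legal theta u, v \in word_realisations theta u & infix w v].
Proof.
move=> /legalP[[|k] [c [W [// _ [v hv hW] wW]]]].
exists v, W; split=> //.
exact: legal_realises (legal_letter c) hv.
Qed.

(** Supplies the context required by [zero_entropy_commute], with an arbitrary legal word placed
    inside [x]. *)
Lemma legal_preimage_between a w : legal theta w ->
  exists y x, [/\ legal theta (a :: rcons y a),
    x \in word_realisations theta y & infix w x].
Proof.
move=> /legal_preimage[u [v [hu hv wv]]].
have [p] := legal_connect (legal_letter a) hu.
move=> /legal_connect /(_ (legal_letter a)) [q hq].
have [p' hp'] := word_realisations_neq0 theta p.
have [q' hq'] := word_realisations_neq0 theta q.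
exists (p ++ u ++ q), (p' ++ v ++ q'); split.
- by rewrite -cats1; move: hq; rewrite -!catA.
- by do 2!apply: word_realisations_cat => //.
- by rewrite infix_catl // infix_catr.
Qed.

Lemma legal_extend w : legal theta w -> exists b c, legal theta (b :: rcons w c).
Proof.
have [[|a [|]] // ha _] := legal_of_size 1.
move=> /(legal_connect ha)[p] /legal_connect /(_ ha) [q].
have -> : ([:: a] ++ p ++ w) ++ q ++ [:: a] =
    belast a p ++ (last a p :: rcons w (head a q)) ++ behead (rcons q a).
  have -> : q ++ [:: a] = head a q :: behead (rcons q a) by rewrite cats1; case: q.
  by rewrite [[:: a] ++ _]catA -[[:: a] ++ p]/(a :: p) lastI -!cats1 -!catA /= -!catA.
by move=> /(legal_infix (infix_infix _ _ _)) h; exists (last a p), (head a q).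
Qed.

(* A point of the subshift is the limit of a nested sequence of legal words,
   each obtained from the previous one by adding a letter at both ends. *)
Lemma legal_in_subshift w : legal theta w ->
  exists2 x, subshift theta x & subword x 0%R (size w) = w.
Proof.
move=> hw; have [w0|w0] := eqVneq w [::].
  by have [[x Xx] _] := prim; exists x; rewrite ?w0.
have d : A by case: w w0 {hw}.
have /choice[e he] : forall u, exists bc : A * A,
    legal theta u -> legal theta (bc.1 :: rcons u bc.2).
  move=> u; have [/legal_extend[b [c h]]|h] := pselect (legal theta u).
    by exists (b, c).
  by exists (d, d) => /h.
pose W k := iter k (fun u => (e u).1 :: rcons u (e u).2) w.
have legW k : legal theta (W k) by elim: k => //= k; apply: he.
have sizeW k : size (W k) = size w + k.*2.
  by elim: k => [|k IH]; rewrite ?addn0 //= size_rcons IH; lia.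
have nthW k j i : i < size (W k) -> nth d (W (k + j)) (i + j) = nth d (W k) i.
  move=> lt; elim: j => [|j IH]; first by rewrite !addn0.
  rewrite !addnS /= nth_rcons -IH ifT //.
  by rewrite -/(W (k + j)); move: lt; rewrite !sizeW; lia.
have sw : 0 < size w by rewrite lt0n size_eq0.
(* [W k] has [k] extra letters on the left, so coordinate [z] sits at index [z + k] of [W k] once
   [k >= |z|]. As [w] is nonempty, even index [2k] lies inside [W k]. *)
pose x (z : int) := nth d (W `|z|%N) `|(z + `|z|%:Z)%R|%N.
have xE z k : `|z|%N <= k -> x z = nth d (W k) `|(z + k%:Z)%R|%N.
  move=> le; rewrite /x -(nthW _ (k - `|z|%N)); last by rewrite sizeW; lia.
  by rewrite subnKC //; congr nth; lia.
have xsub i n k : `|i|%N + n <= k ->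
    subword x i n = take n (drop `|(i + k%:Z)%R|%N (W k)).
  move=> le; apply: (@eq_from_nth _ d).
    rewrite size_mkseq size_takel // size_drop sizeW; lia.
  rewrite size_mkseq => j lt; rewrite nth_mkseq // nth_take // nth_drop.
  by rewrite (xE _ k); [congr nth | ]; lia.
exists x => [i n|].
  rewrite (xsub _ _ _ (leqnn _)); apply: legal_infix (legW (`|i|%N + n)).
  exact: infix_trans (infix_take _ _) (infix_drop _ _).
apply: (@eq_from_nth _ d); first by rewrite size_mkseq.
rewrite size_mkseq => j lt; rewrite nth_mkseq // (xE _ j); last by lia.
by rewrite -(nthW 0 j j) // add0n; congr nth; lia.
Qed.

End Primitive.

(** * Entropy of primitive random substitutions *)

Section PositiveEntropy.
Variables (A : finType) (theta : random_substitution A).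
Hypothesis prim : primitive theta.
Implicit Types (u v w : seq A) (a b c : A).

Definition legal_words n : seq (seq A) :=
  map val (enum [set w : n.-tuple A | `[<legal theta w>]]%SET).

Lemma legal_wordsP n w :
  reflect (legal theta w /\ size w = n) (w \in legal_words n).
Proof.
apply: (iffP mapP) => [[t]|[hw sw]].
  by rewrite mem_enum inE => /asboolP ht ->; rewrite size_tuple.
exists (Tuple (introT eqP sw)) => //.
by rewrite mem_enum inE; apply/asboolP.
Qed.

Lemma uniq_legal_words n : uniq (legal_words n).
Proof. by rewrite map_inj_uniq ?enum_uniq //; apply: val_inj. Qed.

Lemma complexity_legal_words n :
  complexity (subshift theta) n = size (legal_words n).
Proof.
rewrite size_map -cardE; apply: eq_card => w; rewrite !inE.
apply/asboolP/asboolP => [[x Xx [i <-]]|/(legal_in_subshift prim)[x Xx]].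
  exact: Xx.
by rewrite size_tuple => e; exists x => //; exists 0%R.
Qed.

Lemma complexity_gt0 n : 0 < complexity (subshift theta) n.
Proof.
rewrite complexity_legal_words; have [w hw sw] := legal_of_size prim n.
have : w \in legal_words n by apply/legal_wordsP.
by case: legal_words.
Qed.

Lemma complexityD m n : complexity (subshift theta) (m + n) <=
  complexity (subshift theta) m * complexity (subshift theta) n.
Proof.
rewrite !complexity_legal_words -(size_allpairs cat).
apply: uniq_leq_size; first exact: uniq_legal_words.
move=> w /legal_wordsP[hw sw]; apply/allpairsP; exists (take m w, drop m w) => /=.
split; last by rewrite cat_take_drop.
- by apply/legal_wordsP; split; [apply: legal_infix hw; apply: infix_take |
     rewrite size_takel // sw leq_addr].
- by apply/legal_wordsP; split; [apply: legal_infix hw; apply: infix_drop |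
     rewrite size_drop sw addKn].
Qed.

(** * Exponential growth from free choices *)

Section FreeChoice.
Variables (K : nat) (F : A -> bool -> seq A).
Hypothesis F_realises : forall a e, realises theta K [:: a] (F a e).
Hypothesis F_size : forall a, size (F a true) = size (F a false).
Hypothesis F_neq : forall a, F a true <> F a false.

Definition choose_realisation u (e : seq bool) : seq A :=
  flatten (map (fun x => F x.1 x.2) (zip u e)).

Let L u := \sum_(a <- u) size (F a true).

Lemma size_choose_realisation u e :
  size e = size u -> size (choose_realisation u e) = L u.
Proof.
rewrite /L; elim: u e => [|a u IH] [|b e] //=; first by rewrite big_nil.
move=> [se]; rewrite /choose_realisation /= size_cat -/(choose_realisation u e).
by rewrite IH // big_cons; case: b; rewrite // F_size.
Qed.

Lemma choose_realisation_inj u e e' : size e = size u -> size e' = size u ->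
  choose_realisation u e = choose_realisation u e' -> e = e'.
Proof.
elim: u e e' => [|a u IH] [|b e] // [|b' e'] //= [se] [se'].
rewrite /choose_realisation /= => /eqP; rewrite eqseq_cat; last first.
  by case: b b' => [] []; rewrite // F_size.
move=> /andP[/eqP eF /eqP h]; rewrite (IH e e' se se' h); congr (_ :: _).
by case: b b' eF => [] [] // h'; [case: (F_neq h') | case: (F_neq (esym h'))].
Qed.

Lemma realises_choose_realisation u e :
  size e = size u -> realises theta K u (choose_realisation u e).
Proof.
elim: u e => [|a u IH] [|b e] //=.
  by move=> _; rewrite /choose_realisation /=; elim: (K) => //= k IH; exists [::]; rewrite ?inE.
move=> [se]; rewrite /choose_realisation /= -[a :: u]cat1s.
by apply: realises_cat => //; apply: IH.
Qed.

(** Distinct choice sequences give distinct realisations of [u], all legal and of the same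
    length. *)
Lemma complexity_exponential u : legal theta u ->
  2 ^ size u <= complexity (subshift theta) (L u).
Proof.
move=> hu; rewrite complexity_legal_words.
rewrite -card_bool -card_tuple cardE -(size_map (fun e : (size u).-tuple bool =>
  choose_realisation u e)).
apply: uniq_leq_size.
  rewrite map_inj_uniq ?enum_uniq // => e e' h; apply: val_inj.
  by apply: choose_realisation_inj h; rewrite size_tuple.
move=> _ /mapP[e _ ->]; apply/legal_wordsP; split.
  by apply: legal_realises hu _; apply: realises_choose_realisation; rewrite size_tuple.
by apply: size_choose_realisation; rewrite size_tuple.
Qed.

End FreeChoice.

(** * Consequences for the topological entropy *)

Section Entropy.
Import Order.TTheory GRing.Theory Num.Theory.
Import numFieldNormedType.Exports.
Local Open Scope classical_set_scope.
Local Open Scope ring_scope.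
Variable R : realType.

(** Complexity is submultiplicative, so Fekete's lemma shows that [limn] is a genuine limit here. *)
Lemma cvg_topological_entropy :
  ln ((complexity (subshift theta) n)%:R : R) / n%:R @[n --> \oo]
    --> topological_entropy R (subshift theta).
Proof.
have [||l cvl _] := @fekete R (fun n => ln ((complexity (subshift theta) n)%:R)).
- by move=> n; rewrite ln_ge0 // ler1n complexity_gt0.
- move=> m n; rewrite -lnM ?posrE ?ltr0n ?complexity_gt0 //.
  by rewrite ler_ln ?posrE ?mulr_gt0 ?ltr0n ?complexity_gt0 // -natrM ler_nat complexityD.
by rewrite /topological_entropy (cvg_lim _ cvl).
Qed.

(** With [C] the largest length of a choice, a legal word of size [n] yields [2 ^ n] legal words of
    one length between [n] and [n * C]. The averages are thus at least [ln 2 / C] at arbitrarily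
    large lengths. *)
Lemma free_choice_entropy K (F : A -> bool -> seq A) :
  (forall a e, realises theta K [:: a] (F a e)) ->
  (forall a, size (F a true) = size (F a false)) ->
  (forall a, F a true <> F a false) ->
  topological_entropy R (subshift theta) <> 0.
Proof.
move=> hF sF nF h0; have := cvg_topological_entropy; rewrite h0 => /cvgrPdist_lt cv.
pose C := \max_a size (F a true).
have C0 : (0 < C)%N.
  have [[|a [|]] // _ _] := legal_of_size prim 1.
  apply: leq_trans (leq_bigmax a); apply: leq_trans (size_realises (hF a true)).
  by [].
have ln2 : 0 < ln 2 :> R by rewrite ln_gt0 // ltr1n.
have C0' : 0 < C%:R :> R by rewrite ltr0n.
have [N _ hN] := cv (ln 2 / C%:R) (divr_gt0 ln2 C0').
have [u hu su] := legal_of_size prim N.+1.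
pose L := (\sum_(a <- u) size (F a true))%N.
have leL : (N.+1 <= L <= N.+1 * C)%N.
  rewrite -su -sum1_size big_distrl /=; apply/andP; split; apply: leq_sum => a _.
    exact: leq_trans (size_realises (hF a true)).
  by rewrite mul1n (leq_bigmax a).
have /= := hN L; rewrite sub0r normrN => /(_ ltac:(move: leL => /=; lia)).
have L0 : 0 < L%:R :> R by rewrite ltr0n; lia.
apply/negP; rewrite -leNgt; apply: le_trans (ler_norm _).
rewrite ler_pdivrMr // mulrAC ler_pdivlMr //.
have le2 := complexity_exponential hF sF nF hu.
apply: (@le_trans _ _ (ln ((2 ^ N.+1)%:R) * C%:R)); last first.
  rewrite ler_wpM2r // ler_ln ?posrE ?ltr0n ?expn_gt0 ?complexity_gt0 //.
  by rewrite ler_nat -su.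
rewrite natrX lnXn // -[ln 2 *+ _]mulr_natr -mulrA ler_wpM2l ?(ltW ln2) // -natrM ler_nat.
by case/andP: leL.
Qed.

(** At level [K] each letter [b] has a realisation containing [a y a]. Realising its two outer
    letters as [u], [v] or as [v], [u], with everything else fixed, would give the two choices for
    [free_choice_entropy]. *)
Lemma zero_entropy_commute a u v x y :
  topological_entropy R (subshift theta) = 0 ->
  u \in theta a -> v \in theta a ->
  legal theta (a :: rcons y a) -> x \in word_realisations theta y ->
  u ++ x ++ v = v ++ x ++ u.
Proof.
move=> h0 hu hv /(legal_recurrent prim)[K hK] hx; apply: contrapT => neq.
have /choice[F hF] : forall b, exists p : seq A * seq A,
  [/\ realises theta K.+1 [:: b] p.1, realises theta K.+1 [:: b] p.2,
      size p.1 = size p.2 & p.1 <> p.2].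
  move=> b; have [W hW /infixP[s [t eW]]] := hK K b (leqnn K).
  have [s' hs] := word_realisations_neq0 theta s.
  have [t' ht] := word_realisations_neq0 theta t.
  have real u' v' : u' \in theta a -> v' \in theta a ->
      realises theta K.+1 [:: b] (s' ++ (u' ++ x ++ v') ++ t').
    rewrite -!word_realisations1 => hu' hv'; exists W => //; rewrite eW.
    rewrite -[a :: _]cat1s -cats1.
    by do !apply: word_realisations_cat => //.
  exists (s' ++ (u ++ x ++ v) ++ t', s' ++ (v ++ x ++ u) ++ t'); split.
  - exact: real.
  - exact: real.
  - by rewrite /= !size_cat; lia.
  - move=> /eqP; rewrite eqseq_cat // eqxx /= eqseq_cat; last by rewrite !size_cat; lia.
    by move=> /andP[/eqP /neq].
pose G b (e : bool) := if e then (F b).1 else (F b).2.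
apply: (@free_choice_entropy K.+1 G) h0.
- by move=> b []; have [] := hF b.
- by move=> b; have [] := hF b.
- by move=> b; have [] := hF b.
Qed.

End Entropy.
End PositiveEntropy.

(** * Deterministic substitutions *)

Section Deterministic.
Import numFieldNormedType.Exports.
Variables (A : finType) (eta : random_substitution A).
Implicit Types (u v w : seq A) (a b c : A).

Lemma deterministic_morph : deterministic eta ->
  exists2 f : A -> seq A, forall a, f a != [::] &
    forall k u w, realises eta k u w -> w = iter k (morph f) u.
Proof.
move=> det.
have /choice[f hf] : forall a, exists w, eta a = [fset w]%fset.
  by move=> a; apply/cardfs1P/eqP; apply: det.
have wr u w : w \in word_realisations eta u -> w = morph f u.
  elim: u w => [|a u IH] w; first by rewrite word_realisations0 => /eqP.
  move=> /word_realisations_consP[v [w' [hv /IH -> ->]]].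
  by move: hv; rewrite hf inE => /eqP ->.
exists f => [a|k u]; first by apply: (@realisations_nonempty _ eta a); rewrite hf inE.
by elim: k => //= k IH w [v /IH -> /wr].
Qed.

Lemma topological_entropy_deterministic (R : realType) :
  deterministic eta -> topological_entropy R (subshift eta) = 0%R.
Proof.
move=> /deterministic_morph[f f0 hf]; have [C hC] := morphism_factor_count f0.
have cv := @cvg_ln_quadratic R (complexity (subshift eta)) C.
rewrite /topological_entropy (cvg_lim _ (cv _)) // => n n1; apply: hC => // w.
rewrite inE => /asboolP[x Xx [i <-]].
have /legalP[k [a [v [_ /hf -> h]]]] := Xx i n.
by exists k, a.
Qed.

Lemma word_realisations_const (r : seq A) u :
  (forall a, eta a = [fset r]%fset) ->
  word_realisations eta u =i [:: word_pow r (size u)].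
Proof.
move=> hr; elim: u => [|a u IH] w; first by rewrite word_realisations0 inE.
rewrite inE; apply/word_realisations_consP/eqP => [[v [w' [hv]]]|->].
  rewrite IH inE => /eqP -> ->.
  by move: hv; rewrite hr inE => /eqP ->.
by exists r, (word_pow r (size u)); rewrite hr IH !inE.
Qed.

(** The value is [t t] because with value [t] no word would grow when [t] is a single letter. *)
Lemma legal_const (t : seq A) b w : t != [::] ->
  (forall a, eta a = [fset word_pow t 2]%fset) ->
  legal eta w <-> exists n, infix w (word_pow t n).
Proof.
move=> t0 ht; rewrite legalP; split=> [[[|k] [a [W [// _ [v _]]]]]|[n hn]].
  rewrite (word_realisations_const _ ht) inE word_powM => /eqP -> hw.
  by exists (size v * 2).
(* Each step turns [t^N] into [t^(2 N |t|)], so the exponent at least doubles and stays above the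
   level. *)
have [N leN hN] : exists2 N, n < N & realises eta n.+1 [:: b] (word_pow t N).
  elim: n {hn} => [|n [N lt hN]].
    exists 2 => //; exists [:: b] => //.
    by rewrite (word_realisations_const _ ht) inE word_powM.
  exists (size (word_pow t N) * 2).
    rewrite size_word_pow muln2; apply: (@leq_trans N.*2); first by lia.
    by rewrite leq_double leq_pmulr // lt0n size_eq0.
  exists (word_pow t N) => //.
  by rewrite (word_realisations_const _ ht) inE word_powM.
exists n.+1, b, (word_pow t N); split=> //.
apply: infix_prefix_trans hn _; apply: prefix_word_pow_le; exact: ltnW.
Qed.

End Deterministic.

Lemma constant_substitution (A : finType) (r : seq A) : r != [::] ->
  exists eta : random_substitution A, forall a, eta a = [fset r]%fset.
Proof.
move=> r0.
have ne (a : A) : [fset r]%fset != fset0 by apply/fset0Pn; exists r; rewrite inE.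
have nw (a : A) w : w \in [fset r]%fset -> w != [::] by rewrite inE => /eqP ->.
by exists (RandomSubstitution ne nw).
Qed.

(** * Periodicity at zero entropy *)

Section ZeroEntropy.
Variables (A : finType) (theta : random_substitution A).
Hypothesis prim : primitive theta.

(* With [v = u t], the relation [u x v = v x u] says that [x u] commutes with
   [t], so that it is a prefix of a power of [t]. *)
Lemma zero_entropy_periodic (R : realType) :
  topological_entropy R (subshift theta) = 0%R -> ~ deterministic theta ->
  exists2 t : seq A, t != [::] &
    forall w, legal theta w <-> exists n, infix w (word_pow t n).
Proof.
move=> h0 /existsNP[a /eqP ha].
have [u [v [hu hv uv le_uv]]] : exists u v,
    [/\ u \in theta a, v \in theta a, u != v & size u <= size v].
  have /fset0Pn[u hu] := realisations_neq0 theta a.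
  have /fset0Pn[v] : (theta a `\ u)%fset != fset0.
    by apply: contra ha => /eqP e; rewrite (cardfsD1 u) hu e cardfs0.
  rewrite !inE => /andP[vu hv].
  case: (leqP (size u) (size v)) => [le|/ltnW le]; last by exists v, u.
  by exists u, v; rewrite eq_sym.
have comm := zero_entropy_commute prim h0 hu hv.
(* Both [u] and [v] are prefixes of [u x v = v x u], so the shorter one is a prefix of the other. *)
have [t ev] : exists t, v = u ++ t.
  have [y [x [hy hx _]]] := legal_preimage_between prim a (legal_letter prim a).
  have e := comm _ _ hy hx.
  apply/prefixP; apply: (prefix_prefix_size (w := u ++ x ++ v)) le_uv.
    exact: prefix_prefix.
  by rewrite e prefix_prefix.
have t0 : t != [::] by apply: contra uv => /eqP t0; rewrite ev t0 cats0.
have xu w : legal theta w -> exists x,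
    [/\ legal theta (x ++ u), infix w x &
        prefix (x ++ u) (word_pow t (size (x ++ u)))].
  move=> /(legal_preimage_between prim a)[y [x [hy hx wx]]]; exists x; split=> //.
    apply: (legal_word_realisations (u := rcons y a)).
      by apply: legal_infix hy; rewrite infix_cons.
    by rewrite -cats1; apply: word_realisations_cat; rewrite ?word_realisations1.
  (* Cancelling the leading [u] in [u x u t = u t x u] shows that [x u] commutes with [t]. *)
  apply: commute_prefix_pow => //.
  have := comm _ _ hy hx; rewrite ev -!catA => /eqP.
  by rewrite eqseq_cat // eqxx /= => /eqP.
exists t => // w; split=> [/xu[x [_ wx px]]|[n wn]].
  exists (size (x ++ u)); apply: infix_prefix_trans px.
  exact: infix_catr.
(* A legal [z] as long as [t^n] forces [x u] to be at least that long; since [x u] is a prefix of a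
   power of [t], it then begins with [t^n]. *)
have [z hz sz] := legal_of_size prim (n * size t).
have [x [hxu zx px]] := xu z hz.
apply: legal_infix hxu; apply: infix_trans wn _; apply: prefixW.
apply: (prefix_prefix_size _ px); last first.
  by rewrite size_word_pow -sz size_cat (leq_trans (size_infix zx)) ?leq_addr.
apply: prefix_word_pow_le; rewrite size_cat.
apply: leq_trans (leq_addr _ _); apply: leq_trans (size_infix zx).
by rewrite sz leq_pmulr // lt0n size_eq0.
Qed.

Lemma zero_entropy_deterministic (R : realType) :
  topological_entropy R (subshift theta) = 0%R ->
  exists eta : random_substitution A,
    [/\ deterministic eta, primitive eta & subshift theta = subshift eta].
Proof.
move=> h0; have [det|ndet] := pselect (deterministic theta); first by exists theta.
have [t t0 ht] := zero_entropy_periodic h0 ndet.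
have [[|b [|]] // _ _] := legal_of_size prim 1.
have r0 : word_pow t 2 != [::].
  by rewrite -size_eq0 size_word_pow muln_eq0 size_eq0.
have [eta heta] := constant_substitution r0.
have legE w : legal theta w <-> legal eta w.
  exact: iff_trans (ht w) (iff_sym (legal_const b w t0 heta)).
have eX : subshift theta = subshift eta.
  by apply/seteqP; split=> x hx i n; apply/legE; apply: hx.
exists eta; split=> //; first by move=> a; rewrite heta cardfs1.
split; first by rewrite -eX; case: prim.
(* Every letter is legal, hence occurs in a power of [t] and so in [t] itself; level 1 therefore
   witnesses primitivity. *)
exists 1 => // a c; exists (word_pow t 2); first by rewrite power1 heta fset11.
have /ht[n /mem_infix /(_ a)] := legal_letter prim a.
rewrite mem_head => /(_ isT) /flattenP[s]; rewrite mem_nseq => /andP[_ /eqP ->] ha.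
by rewrite mem_cat ha.
Qed.

End ZeroEntropy.

Local Open Scope ring_scope.

Theorem theorem3p1 (R : realType) (A : finType) (theta : random_substitution A)
    (theta_primitive : primitive theta) :
  (topological_entropy R (subshift theta) = 0 <->
   exists eta : random_substitution A,
     deterministic eta /\ subshift theta = subshift eta) /\
  (topological_entropy R (subshift theta) = 0 ->
   exists eta : random_substitution A,
     [/\ deterministic eta, primitive eta & subshift theta = subshift eta]).
Proof.
split; last exact: zero_entropy_deterministic.
split=> [/(zero_entropy_deterministic theta_primitive)[eta [det _ eX]]|].
  by exists eta.
by move=> [eta [det ->]]; apply: topological_entropy_deterministic.
Qed.
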